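(* Let $\Gamma=(V,E)$ be a simple graph of order $n$, minimum degree $\delta$ and maximum degree $\Delta$, and let $k\in\{-\Delta,\dots,\Delta\}$. Then $$\left\lceil\frac{\delta+k-2}{2}\right\rceil\ \le\ \phi_k^{o}(\Gamma)\ \le\ \left\lfloor\frac{2n-\delta+k-3}{2}\right\rfloor .$$
   Context: For $S\subseteq V$ and $v\in V$, $\delta_S(v)$ denotes the number of neighbors of $v$ in $S$, and $\overline{S}=V\setminus S$. The boundary $\partial S$ is the set of vertices of $\overline{S}$ having at least one neighbor in $S$. For an integer $k$, a nonempty set $S\subseteq V$ is an offensive $k$-alliance if $\delta_S(v)\ge\delta_{\overline{S}}(v)+k$ for every $v\in\partial S$. A set $X\subseteq V$ is offensive $k$-alliance free ($k$-oaf) if no subset of $X$ is an offensive $k$-alliance. $\phi_k^{o}(\Gamma)$ denotes the largest cardinality of a $k$-oaf set in $\Gamma$.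
   Formalization: The upper bound is stated except when Γ is complete and k = −Δ, where it would read φ ≤ −1 although the empty set is k-oaf, so φ ≥ 0; the lower bound is stated in all cases. The graph is assumed to have at least one vertex. *)

(* Defs.v *)
From HB Require Import structures.
From mathcomp Require Import all_boot all_order all_algebra.

Set Implicit Arguments.
Unset Strict Implicit.
Unset Printing Implicit Defensive.

Import Order.TTheory GRing.Theory Num.Theory.
Local Open Scope ring_scope.

(* A simple graph on the vertex type T is a symmetric irreflexive e : rel T;
   these two properties are hypotheses of the theorem, not part of the
   definitions below. *)

Definition deg_in (T : finType) (e : rel T) (S : {set T}) (v : T) : nat :=
  #|[set u in S | e v u]|.

Definition degree (T : finType) (e : rel T) (v : T) : nat := deg_in e setT v.

(* The neutral element #|T| bounds every degree, so on a nonempty T this is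
   the true minimum. *)
Definition min_degree (T : finType) (e : rel T) : nat :=
  \big[minn/#|T|]_(v : T) degree e v.

Definition max_degree (T : finType) (e : rel T) : nat :=
  (\max_(v : T) degree e v)%N.

Definition boundary (T : finType) (e : rel T) (S : {set T}) : {set T} :=
  [set v in ~: S | [exists u in S, e v u]].

Definition offensive_alliance (T : finType) (e : rel T) (k : int)
    (S : {set T}) : bool :=
  (S != set0) &&
  [forall v in boundary e S, (deg_in e (~: S) v)%:Z + k <= (deg_in e S v)%:Z].

Definition offensive_alliance_free (T : finType) (e : rel T) (k : int)
    (X : {set T}) : bool :=
  [forall S : {set T}, (S \subset X) ==> ~~ offensive_alliance e k S].

(* Alliances are nonempty, so set0 is always alliance free and the maximum
   ranges over a nonempty family. *)
Definition phi_o (T : finType) (e : rel T) (k : int) : nat :=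
  (\max_(X : {set T} | offensive_alliance_free e k X) #|X|)%N.

(* For a complete graph on n vertices and k = - (n - 1) = - max_degree e, the
   quantity floor ((2 n - min_degree e + k - 3) / 2) equals -1, so it cannot
   bound phi_o e k (which is 0) from above. *)
Definition complete_graph (T : finType) (e : rel T) : Prop :=
  forall x y : T, x != y -> e x y.

(* Main.v *)
Require Import Defs.
From HB Require Import structures.
From mathcomp Require Import all_boot all_order all_algebra.
From mathcomp Require Import zify lra.

(** Everything reduces to degree counting, using that the alliance condition
    at a boundary vertex [v] of [S] reads
    [degree v + k <= 2 * deg_in S v].

    Lower bound.  The difficulty is that a set with empty boundary (a union of
    components) is an alliance for every [k], so a small set need not be
    alliance free.  This is avoided by working inside the neighbourhood of one
    vertex [v]: [v] lies outside that neighbourhood and so on the boundary of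
    each of its nonempty subsets [S], where the condition forces
    [degree v + k <= 2 * #|S|].  Hence any set of neighbours of [v] smaller
    than that is alliance free ([neighbours_oaf]).  Taking [v] of maximum
    degree makes the neighbourhood large enough for such sets to reach the
    claimed size, because [k] is at most the maximum degree
    ([degree_le_phi_o]).

    Upper bound.  A nonempty alliance-free [X] is in particular not an alliance
    itself, so some [v] on its boundary violates the condition.  As [v] has at
    most [#|~: X| - 1] neighbours outside [X], this bounds [#|~: X|] from below
    ([nonempty_oaf_cocard]).  The empty set has to be treated apart: there the
    bound says [min_degree e - k <= 2 * #|T| - 3], which can only fail when
    [min_degree e = #|T| - 1] and [k = - (#|T| - 1)], that is for a complete
    graph and the least admissible [k]. *)

Set Implicit Arguments.
Unset Strict Implicit.
Unset Printing Implicit Defensive.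

Import Order.TTheory GRing.Theory Num.Theory.
Local Open Scope ring_scope.

Lemma degreeE (T : finType) (e : rel T) (v : T) :
  degree e v = #|[set u | e v u]|.
Proof. by apply: eq_card => u; rewrite !inE. Qed.

Lemma degree_split (T : finType) (e : rel T) (S : {set T}) (v : T) :
  degree e v = (deg_in e S v + deg_in e (~: S) v)%N.
Proof.
rewrite degreeE -(cardsID S); congr (_ + _)%N;
  by apply: eq_card => u; rewrite !inE // andbC.
Qed.

Lemma deg_in_le_card (T : finType) (e : rel T) (S : {set T}) (v : T) :
  (deg_in e S v <= #|S|)%N.
Proof. by apply/subset_leq_card/subsetP => u; rewrite inE => /andP[]. Qed.

Lemma deg_in_lt_card (T : finType) (e : rel T) (S : {set T}) (v : T) :
  irreflexive e -> v \in S -> (deg_in e S v < #|S|)%N.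
Proof.
move=> e_irr vS; apply/proper_card/properP; split.
  by apply/subsetP => u; rewrite inE => /andP[].
by exists v => //; rewrite inE e_irr andbF.
Qed.

Lemma degree_lt_card (T : finType) (e : rel T) (v : T) :
  irreflexive e -> (degree e v < #|T|)%N.
Proof. by move=> e_irr; rewrite -cardsT; apply: deg_in_lt_card; rewrite ?inE. Qed.

Lemma min_degree_le (T : finType) (e : rel T) (v : T) :
  (min_degree e <= degree e v)%N.
Proof. by have := bigmin_le #|T| v (degree e); rewrite minEnat leEnat. Qed.

Lemma degree_le_max (T : finType) (e : rel T) (v : T) :
  (degree e v <= max_degree e)%N.
Proof. exact: leq_bigmax. Qed.

Lemma max_degree_lt_card (T : finType) (e : rel T) :
  irreflexive e -> (0 < #|T|)%N -> (max_degree e < #|T|)%N.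
Proof.
move=> e_irr T_gt0; rewrite /max_degree; have [v ->] := bigop.eq_bigmax (degree e) T_gt0.
exact: degree_lt_card.
Qed.

(** A vertex of degree [#|T| - 1] misses only itself. *)
Lemma complete_of_min_degree (T : finType) (e : rel T) :
  irreflexive e -> (#|T| <= (min_degree e).+1)%N -> complete_graph e.
Proof.
move=> e_irr le_T x y neq_xy; apply: contraLR le_T => nexy.
rewrite -ltnNge; apply: leq_ltn_trans (_ : (degree e x).+1 < _)%N.
  by rewrite ltnS min_degree_le.
have sub : [set u | e x u] \subset ~: [set x; y].
  apply/subsetP => u; rewrite !inE negb_or => exu.
  by apply/andP; split; apply: contraTneq exu => ->; rewrite ?e_irr.
have := subset_leq_card sub; have := cardsC [set x; y].
by rewrite -degreeE cards2 neq_xy; lia.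
Qed.

Lemma oaf_card_le_phi (T : finType) (e : rel T) (k : int) (X : {set T}) :
  offensive_alliance_free e k X -> (#|X| <= phi_o e k)%N.
Proof. exact: leq_bigmax_cond. Qed.

(** Every nonempty [S \subset X] has [v] on its boundary, and the alliance
    condition fails at [v] because [S] has fewer than [(degree e v + k) / 2]
    elements. *)
Lemma neighbours_oaf (T : finType) (e : rel T) (k : int) (v : T)
    (X : {set T}) :
  irreflexive e -> X \subset [set u | e v u] ->
  2 * #|X|%:Z < (degree e v)%:Z + k ->
  offensive_alliance_free e k X.
Proof.
move=> e_irr XN Xlt; apply/forallP => S; apply/implyP => SX.
have SN w : w \in S -> e v w by move=> /(subsetP SX)/(subsetP XN); rewrite inE.
apply/negP => /andP[/set0Pn[u uS] /forall_inP ally].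
have {}/ally : v \in boundary e S.
  rewrite !inE; apply/andP; split; first by apply/negP => /SN; rewrite e_irr.
  by apply/existsP; exists u; rewrite uS SN.
have := deg_in_le_card e S v; have := subset_leq_card SX.
by rewrite (degree_split e S v) in Xlt; lia.
Qed.

Lemma degree_le_phi_o (T : finType) (e : rel T) (k : int) (v : T) :
  irreflexive e -> k <= (degree e v)%:Z ->
  (degree e v)%:Z + k - 2 <= 2 * (phi_o e k)%:Z.
Proof.
move=> e_irr k_le; rewrite leNgt; apply/negP => phi_lt.
(* Otherwise [phi_o e k + 1] neighbours of [v] would still be alliance free. *)
have /card_geqP[s [s_uniq s_size sN]] : (phi_o e k < #|[set u | e v u]|)%N.
  by rewrite -degreeE; lia.
have cards : #|[set u in s]| = (phi_o e k).+1.
  by rewrite -s_size -(card_uniqP s_uniq); apply: eq_card => u; rewrite inE.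
suff /oaf_card_le_phi : offensive_alliance_free e k [set u in s].
  by rewrite cards ltnn.
apply: (neighbours_oaf (v := v)) => //; last by rewrite cards; lia.
by apply/subsetP => u; rewrite inE => /sN.
Qed.

(** The constant 3 is 1 + 2: the alliance condition fails by at least 1 at some
    boundary vertex, and that vertex is not its own neighbour, which saves 1 in
    a term counted twice. *)
Lemma nonempty_oaf_cocard (T : finType) (e : rel T) (k : int) (X : {set T}) :
  irreflexive e -> X != set0 -> offensive_alliance_free e k X ->
  (min_degree e)%:Z - k + 3 <= 2 * #|~: X|%:Z.
Proof.
move=> e_irr X_neq0 /forallP/(_ X); rewrite subxx /offensive_alliance X_neq0 /=.
rewrite negb_forall_in => /exists_inP[v v_bd].
have vC : v \in ~: X by move: v_bd; rewrite inE => /andP[].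
have := deg_in_lt_card e_irr vC; have := min_degree_le e v.
by rewrite (degree_split e X v) -ltNge; lia.
Qed.

Theorem theorem18 (T : finType) (e : rel T) (k : int)
    (e_sym : symmetric e) (e_irr : irreflexive e) (T_gt0 : (0 < #|T|)%N)
    (k_ge : - (max_degree e)%:Z <= k) (k_le : k <= (max_degree e)%:Z) :
  Num.ceil (((min_degree e)%:R + k%:~R - 2) / 2 : rat) <= (phi_o e k)%:Z
  /\ (~ (complete_graph e /\ k = - (max_degree e)%:Z) ->
      (phi_o e k)%:Z
        <= Num.floor ((2 * #|T|%:R - (min_degree e)%:R + k%:~R - 3) / 2 : rat)).
Proof.
split=> [|not_extremal].
  suff : (min_degree e)%:Z + k - 2 <= 2 * (phi_o e k)%:Z.
    by rewrite ceil_le_int -(ler_int rat) !rmorphE /= => ?; lra.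
  have [v Dv] := bigop.eq_bigmax (degree e) T_gt0; rewrite -/(max_degree e) in Dv.
  rewrite Dv in k_le; have := degree_le_phi_o e_irr k_le.
  by have := min_degree_le e v; lia.
suff phi_le : 2 * (phi_o e k)%:Z <= 2 * #|T|%:Z - (min_degree e)%:Z + k - 3.
  by rewrite floor_ge_int; move: phi_le; rewrite -(ler_int rat) !rmorphE /= => ?; lra.
have [X oafX ->] : {X | offensive_alliance_free e k X & phi_o e k = #|X|}.
  apply: eq_bigmax_cond; apply/card_gt0P; exists set0.
  apply/forallP => S; rewrite subset0; apply/implyP => /eqP->.
  by rewrite /offensive_alliance eqxx.
have [X0|X_neq0] := eqVneq X set0; last first.
  by have := nonempty_oaf_cocard e_irr X_neq0 oafX; have := cardsC X; lia.
rewrite X0 cards0 leNgt; apply/negP => lt_bound.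
have Delta_lt := max_degree_lt_card e_irr T_gt0.
have /card_gt0P[v _] := T_gt0.
have := min_degree_le e v; have := degree_lt_card v e_irr => deg_lt min_le.
apply: not_extremal; split; last by lia.
by apply: complete_of_min_degree => //; lia.
Qed.
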